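(* Let $\Gamma$ be a finitely generated, residually finite group with finite generating set $X$. If there exists $\alpha>1$ such that $\alpha^n\preceq \mathrm{w}_{\Gamma,X}(n)$, then $\mathrm{F}_{\Gamma,X}(n)\not\preceq(\log n)^r$ for every $r\in\mathbb{R}$ (that is, $\mathrm{F}_{\Gamma,X}(n)\preceq(\log n)^r$ holds for no $r\in\mathbb{R}$).
   Context: $\|\cdot\|_X$ denotes word length with respect to $X$, and $\mathrm{w}_{\Gamma,X}(n)=|\{\gamma\in\Gamma:\|\gamma\|_X\le n\}|$. $\mathrm{F}_{\Gamma,X}(n)$ is the smallest positive integer $N$ such that for every nontrivial $\gamma\in\Gamma$ with $\|\gamma\|_X\le n$ there is a normal subgroup of $\Gamma$ of finite index at most $N$ not containing $\gamma$. For functions $f_1,f_2$ on the positive integers with values in $[0,\infty]$, $f_1\preceq f_2$ means that there is a constant $C$ (a positive integer) such that $f_1(n)\le C f_2(Cn)$ for all $n\geq 1$; this includes the requirement that the right-hand side is defined. *)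

(* Defs.v *)
From mathcomp Require Import all_boot all_order all_algebra finmap.
From mathcomp Require Import all_classical all_reals all_analysis.

Set Implicit Arguments.
Unset Strict Implicit.
Unset Printing Implicit Defensive.

Import Order.TTheory GRing.Theory Num.Theory.

Local Open Scope classical_set_scope.

(* Junk value 0 when no natural number satisfies P. *)
Definition least (P : set nat) : nat :=
  match pselect (exists n, `[< P n >]) with
  | left exP => ex_minn exP
  | right _ => 0
  end.

Lemma leastP (P : set nat) :
  P !=set0 -> P (least P) /\ (forall n, P n -> least P <= n).
Proof.
move=> [n Pn]; rewrite /least; case: pselect => [exP|[]].
  by case: ex_minnP => m /asboolP Pm mP; split=> // k /asboolP; exact: mP.
by exists n; apply/asboolP.
Qed.

Section Groups.
Variable G : groupType.
Implicit Types (X H : set G) (g x y : G) (n N : nat).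
Local Open Scope group_scope.

Definition is_subgroup H : Prop :=
  [/\ H 1, (forall x y, H x -> H y -> H (x * y)) & (forall x, H x -> H x^-1)].

Definition is_normal_subgroup H : Prop :=
  is_subgroup H /\ (forall x y, H x -> H (x ^ y)).

Definition generates X : Prop :=
  forall H, is_subgroup H -> X `<=` H -> H = [set: G].

Definition left_cosets H : set (set G) :=
  [set [set x * h | h in H] | x in [set: G]].

Definition residually_finite : Prop :=
  forall g, g <> 1 ->
    exists H, [/\ is_normal_subgroup H, finite_set (left_cosets H) & ~ H g].

Definition is_word X (w : seq G) : Prop :=
  forall x, x \in w -> X x \/ X x^-1.

Definition word_length X g : nat :=
  least [set k | exists w, [/\ is_word X w, size w = k & \prod_(x <- w) x = g]].

(* [fset_set] is empty on infinite sets, but balls are finite when X is a finite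
   generating set. *)
Definition word_growth X n : nat :=
  (#|` fset_set [set g | (word_length X g <= n)%N]|)%fset.

Definition detects X n N : Prop :=
  forall g, g <> 1 -> (word_length X g <= n)%N ->
    exists H, [/\ is_normal_subgroup H, (left_cosets H #<= `I_N)%card & ~ H g].

(* A minimum over a nonempty set as soon as X is a finite generating set and G
   is residually finite. *)
Definition res_finite_growth X n : nat :=
  least [set N | (0 < N)%N /\ detects X n N].

End Groups.

Arguments residually_finite : clear implicits.

Section Growth.
Variable R : realType.

(* f2 is a partial function: the comparison requires it to be defined at every
   point C * n. *)
Definition growth_le (f1 : nat -> \bar R) (f2 : nat -> option (\bar R)) : Prop :=
  exists C : nat, (0 < C)%N /\
    forall n : nat, (0 < n)%N ->
      exists y : \bar R,
        f2 (C * n)%N = Some y /\ (f1 n <= C%:R%:E * y)%E.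

(* (log n)^r; undefined at n = 1 for r < 0, where [powR] would give 0. *)
Definition log_power (r : R) (n : nat) : option (\bar R) :=
  if (ln n%:R == 0 :> R)%R && (r < 0)%R then None
  else Some (ln n%:R `^ r)%:E.

End Growth.

(* Main.v *)
(** By hypothesis, every nontrivial element of length at most [2^t] survives in
    a quotient of order polynomial in [t].

    Call a finite quotient prime if any two nontrivial elements [a], [b] have a
    nontrivial commutator [[a^q, b]].  Let [D] be a prime quotient and choose
    short representatives of its elements.  A normal subgroup of index less
    than [#|D|] contains the difference of two of them, by the pigeonhole
    principle.  A balanced nested commutator of all the differences is
    therefore an element of length polynomial in [#|D|] that survives in [D]
    but in no smaller quotient.  Hence [#|D|] is bounded, and all the prime
    quotients factor through one finite quotient of [G], with kernel [core].

    If [D/E] is a nonabelian chief factor of a finite quotient [Q], then [Q]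
    modulo the centralizer of [D/E] is prime; so the image of [core] in any
    finite quotient is solvable.  A solvable group of order at most [N] is
    determined by the [O(log(N)^3)] structure constants of a polycyclic
    sequence, hence the normal subgroups of index at most [N] cut out only
    [exp(O(log(N)^4))] subgroups of [core].  Balls of radius [2^t] embed in
    the product of the corresponding quotients for some [N] polynomial in [t],
    which makes their size subexponential in [2^t]. *)
Require Import Defs.
From mathcomp Require Import all_boot all_order all_algebra all_fingroup all_solvable.

Set Implicit Arguments.
Unset Strict Implicit.
Unset Printing Implicit Defensive.

(** * Finite groups *)

Section Prime.
Local Open Scope group_scope.
Variable gT : finGroupType.
Implicit Types Q I D E C A B : {group gT}.

(** Equivalently, no two nontrivial normal subgroups of [Q / C] commute; the elements [a] and [b]
    stand for their normal closures. The case [C = Q] is allowed. *)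
Definition prime_normal Q C : Prop :=
  C <| Q /\ forall a b, a \in Q -> b \in Q -> a \notin C -> b \notin C ->
    exists2 q, q \in Q & [~ a ^ q, b] \notin C.

(** The witness is the centralizer of the chief factor [D / E]. If [a] and [b] violated primeness,
    their normal closures would commute modulo [C]. Each closure covers [D / E], so [[~: D, D] / E]
    would lie in [C / E]; as [D / E] is perfect, it would be abelian. *)
Lemma prime_normal_chief Q D E :
  D <| Q -> ~~ ([~: D, D] \subset E) ->
  [max E | (E <| Q) && (E \proper D)] ->
  exists2 C, prime_normal Q C & ~~ (D \subset C).
Proof.
move=> nDQ nab /maxgroupP[/andP[nEQ pED] maxE].
have sDQ := normal_sub nDQ; have sED := proper_sub pED.
have nEQ' := normal_norm nEQ; have nED := subset_trans sDQ nEQ'.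
(* By maximality of [E], the product of [E] and [A] is all of [D]. *)
have sat A : A <| Q -> ~~ (A \subset E) -> A \subset D -> D / E = A / E.
  move=> nAQ nAE sAD.
  have nnEA : E <*> A <| Q.
    rewrite /normal join_subG (normal_sub nEQ) (normal_sub nAQ).
    by rewrite normsY ?normal_norm.
  have [|nprop] := boolP (E <*> A \proper D).
    move=> pEA; have := maxE _ _ (joing_subl E A).
    rewrite nnEA pEA => /(_ isT) eqE; case/negP: nAE.
    by rewrite -eqE joing_subr.
  have eD : E <*> A = D.
    apply/eqP; move: nprop; rewrite eqEproper => ->.
    by rewrite join_subG sED sAD.
  by rewrite -eD quotientYidl // (subset_trans (normal_sub nAQ)).
pose C := (Q :&: coset E @*^-1 'C(D / E))%G.
have sCQ A : A \subset Q -> (A \subset C) = ([~: A, D] \subset E).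
  move=> sAQ; have nEA := subset_trans sAQ nEQ'.
  by rewrite subsetI sAQ -sub_morphim_pre //= -quotientE quotient_cents2.
have nDC : ~~ (D \subset C) by rewrite sCQ.
have nCQ : C <| Q.
  rewrite /normal subsetIl normsI ?normG //.
  rewrite -(quotientGK nEQ) morphpre_norms //.
  by rewrite norms_cent // quotient_norms // normal_norm.
exists C => //; split=> // a b aQ bQ naC nbC.
have [/exists_inP //|/exists_inPn H] := boolP [exists q in Q, [~ a ^ q, b] \notin C].
exfalso.
have nclo x : x \in Q -> <<x ^: Q>> <| Q.
  move=> xQ; rewrite /normal gen_subG class_subG ?normG //=.
  by rewrite norms_gen ?class_norm.
pose A := <<a ^: Q>>%G; pose B := <<b ^: Q>>%G.
have nAQ : A <| Q := nclo a aQ; have nBQ : B <| Q := nclo b bQ.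
have nCnQ := normal_norm nCQ.
have sABC : [~: A, B] \subset C.
  rewrite -quotient_cents2; last 2 first.
  - exact: subset_trans (normal_sub nAQ) nCnQ.
  - exact: subset_trans (normal_sub nBQ) nCnQ.
  have scQ x : x \in Q -> x ^: Q \subset 'N(C).
    by move=> xQ; apply: subset_trans nCnQ; rewrite class_subG ?normG.
  rewrite !quotient_gen ?scQ // gen_subG centsC gen_subG centsC quotient_cents2 ?scQ //.
  rewrite gen_subG; apply/subsetP => _ /imset2P[_ _ /imsetP[q qQ ->] /imsetP[q' q'Q ->] ->].
  have -> : [~ a ^ q, b ^ q'] = [~ a ^ (q * q'^-1), b] ^ q'.
    by rewrite conjRg -conjgM mulgKV.
  rewrite memJ_norm ?(subsetP nCnQ) //.
  by have := H (q * q'^-1); rewrite groupM ?groupV // negbK => /(_ isT).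
(* The normal closure of [x] meets [D] in a subgroup containing its commutators with [D]; were these
   in [E], then [x] would centralize [D / E]. *)
have big x : x \in Q -> x \notin C -> D / E = (<<x ^: Q>> :&: D)%G / E.
  move=> xQ xC; have nX := nclo x xQ.
  apply: sat; first by rewrite normalI.
    apply: contra xC => sXE.
    have : <<x ^: Q>>%G \subset C.
      rewrite sCQ ?(normal_sub nX) // (subset_trans _ sXE) // subsetI.
      rewrite commg_subl commg_subr (subset_trans _ (normal_norm nX)) //.
      by rewrite (subset_trans _ (normal_norm nDQ)) ?(normal_sub nX).
    by move/subsetP; apply; rewrite mem_gen ?class_refl.
  exact: subsetIr.
have nDD : [~: D, D] <| Q.
  rewrite /normal normsR ?normal_norm // andbT.
  by rewrite (subset_trans _ sDQ) // commg_subl normG.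
have eDD : D / E = [~: D, D] / E.
  by apply: (sat [~: D, D]%G) => //; rewrite commg_subl normG.
have sDC : [~: D, D] / E \subset C / E.
  rewrite quotientR // {1}(big a) // (big b) // -quotientR /=.
  - by rewrite quotientS // (subset_trans _ sABC) // commgSS ?subsetIl.
  - by rewrite (subset_trans _ nED) ?subsetIr.
  - by rewrite (subset_trans _ nED) ?subsetIr.
case/negP: nab; rewrite -quotient_cents2 // eDD (subset_trans sDC) // -eDD.
rewrite quotient_cents2 ?(subset_trans _ nEQ') ?subsetIl //.
by rewrite -sCQ ?subsetIl.
Qed.

(** Induction on the order of a [Q]-normal [D] inside [I]: a nonabelian top chief factor of [D]
    would give a prime [C] that does not contain [D], although it contains [I]. *)
Lemma solvable_sub_primes Q I :
  I <| Q -> (forall C, prime_normal Q C -> I \subset C) -> solvable I.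
Proof.
move=> nIQ IC.
suff H n D : #|D| <= n -> D <| Q -> D \subset I -> solvable D by exact: (H #|I|).
elim: n D => [|n IHn] D leDn nDQ sDI.
  by move: leDn; rewrite leqNgt cardG_gt0.
have [->|ntD] := eqVneq (D : {set gT}) 1; first exact: solvable1.
have [E maxE _] : {E : {group gT} | [max E | (E <| Q) && (E \proper D)] & 1%G \subset E}.
  by apply: maxgroup_exists; rewrite /= normal1 proper1G.
have /maxgroupP[/andP[nEQ pED] _] := maxE.
have nED : E <| D := normalS (proper_sub pED) (normal_sub nDQ) nEQ.
rewrite (series_sol nED) IHn ?(proper_sub (proper_sub_trans pED sDI)) //=; last first.
  by rewrite -ltnS (leq_trans (proper_card pED)).
apply: abelian_sol; rewrite /abelian quotient_cents2 ?normal_norm //.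
apply/negPn/negP => nab.
have [C pC /negP[]] := prime_normal_chief nDQ nab maxE.
exact: subset_trans sDI (IC C pC).
Qed.
End Prime.

(** * Polycyclic sequences and normal forms *)

Section Tower.
Local Open Scope group_scope.
Implicit Types gT : finGroupType.

Definition tower gT (g : nat -> gT) i : {group gT} := <<[set g l | l : 'I_i]>>%G.

Definition collect gT (g : nat -> gT) i (e : nat -> nat) : gT :=
  \prod_(l < i) g l ^+ e l.

Definition polycyclic gT (g : nat -> gT) b : Prop :=
  forall i, i < b -> g i \in 'N(tower g i).

Lemma mem_tower gT (g : nat -> gT) i l : l < i -> g l \in tower g i.
Proof. by move=> lti; rewrite mem_gen //; apply/imsetP; exists (Ordinal lti). Qed.

Lemma towerS gT (g : nat -> gT) i : tower g i.+1 = tower g i <*> <[g i]> :> {set gT}.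
Proof.
apply/eqP; rewrite eqEsubset gen_subG join_subG cycle_subG mem_tower // andbT.
rewrite gen_subG; apply/andP; split; apply/subsetP => _ /imsetP[[l /= lti] _ ->].
  move: (lti); rewrite ltnS leq_eqVlt => /predU1P[->|ltl].
    by rewrite mem_gen // inE cycle_id orbT.
  by rewrite mem_gen // inE mem_tower.
by rewrite mem_tower // ltnW.
Qed.

Lemma eq_tower gT (g g' : nat -> gT) i :
  (forall l, l < i -> g l = g' l) -> tower g i = tower g' i.
Proof.
by move=> eg; apply/val_inj; congr <<_>>; apply: eq_imset => l; apply: eg.
Qed.

Lemma collect_mem gT (g : nat -> gT) i e : collect g i e \in tower g i.
Proof. by apply: group_prod => l _; rewrite groupX ?mem_tower. Qed.

Lemma tower_collect gT (g : nat -> gT) i x :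
  polycyclic g i -> x \in tower g i ->
  exists2 e : nat -> nat, x = collect g i e & forall l, e l <= #[g l].
Proof.
elim: i x => [|i IHi] x pg.
  have -> : tower g 0 = 1%G.
    apply/val_inj/trivgP; rewrite /= gen_subG; apply/subsetP => _ /imsetP[[]] //.
  move/set1gP => ->; exists (fun=> 0%N) => //; by rewrite /collect big_ord0.
rewrite towerS norm_joinEr ?cycle_subG ?pg // => /mulsgP[h z hT /cyclePmin[t ltt ->] ->].
have {hT} [|e -> le] := IHi h _ hT; first by move=> l ltl; rewrite pg // ltnW.
exists (fun l => if l == i then t else e l) => [|l]; last first.
  by case: eqP => // ->; rewrite ltnW.
rewrite /collect big_ord_recr /= eqxx; congr (_ * _).
by apply: eq_bigr => l _; rewrite ltn_eqF.
Qed.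

(** Passing to a normal subgroup of prime index at least halves the order, so [b] steps suffice.
    Trivial generators pad the sequence to length exactly [b]. *)
Lemma solvable_polycyclic gT (G : {group gT}) b :
  solvable G -> #|G| <= 2 ^ b ->
  exists2 g : nat -> gT, polycyclic g b & tower g b = G.
Proof.
have trivial_tower i (H : {group gT}) : H :=: 1 ->
    exists2 g : nat -> gT, polycyclic g i & tower g i = H.
  move=> H1; exists (fun=> 1) => [j _|]; first exact: group1.
  apply/val_inj; rewrite /= H1; apply/trivgP; rewrite gen_subG.
  by apply/subsetP => _ /imsetP[l _ ->]; rewrite inE.
elim: b G => [|b IHb] G solG leG.
  by apply: trivial_tower; apply/eqP; rewrite trivg_card_le1.
have [G1|ntG] := eqVneq (G : {set gT}) 1; first exact: trivial_tower.
have [H nHG prH] := sol_prime_factor_exists solG ntG.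
have sHG := normal_sub nHG.
have [|g pg tg] := IHb H (solvableS sHG solG).
  rewrite -(leq_pmul2r (prime_gt0 prH)) Lagrange // (leq_trans leG) //.
  by rewrite expnSr leq_mul2l prime_gt1 ?orbT.
have [x xG xH] : exists2 x, x \in G & x \notin H.
  apply/subsetPn; apply/negP => sGH; move: prH.
  by rewrite (_ : G = H) ?indexgg //; apply/val_inj/eqP; rewrite eqEsubset sGH.
pose g' l := if l == b then x else g l.
have tg' i : i <= b -> tower g' i = tower g i.
  by move=> leib; apply: eq_tower => l ltl; rewrite /g' ltn_eqF // (leq_trans ltl).
exists g'.
  move=> i; rewrite ltnS leq_eqVlt => /predU1P[->|ltib].
    by rewrite tg' // tg /g' eqxx (subsetP (normal_norm nHG)).
  by rewrite tg' 1?ltnW // /g' ltn_eqF ?pg.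
apply/val_inj; apply: (etrans (towerS _ _)); rewrite tg' // tg /g' eqxx /=.
have maxH : maximal H G by apply: p_index_maximal.
apply/eqP; rewrite eqEsubset join_subG sHG cycle_subG xG /=.
apply/negPn/negP => nsub.
case/maxgroupP: maxH => _ /(_ (H <*> <[x]>)%G); rewrite properE nsub join_subG sHG cycle_subG xG.
move=> /(_ isT (joing_subl _ _)) eqH; case/negP: xH.
by rewrite -eqH mem_gen // inE cycle_id orbT.
Qed.

Lemma collect_pair gT gT' (g : nat -> gT) (g' : nat -> gT') i e :
  collect (fun l => (g l, g' l)) i e = (collect g i e, collect g' i e).
Proof.
have fstX (x : gT * gT') n : x ^+ n = (x.1 ^+ n, x.2 ^+ n).
  by elim: n => // n IHn; rewrite !expgS IHn.
rewrite /collect; elim: i => [|i IHi]; first by rewrite !big_ord0.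
by rewrite !big_ord_recr /= IHi fstX.
Qed.

(* The subgroup generated by the pairs [(g l, g' l)] is the graph of an
   isomorphism between the two towers. *)
Lemma tower_graph gT gT' (g : nat -> gT) (g' : nat -> gT') b p q c :
  (forall i, i < b -> forall t, (g' i ^+ t \in tower g' i) -> p i %| t) ->
  (forall i, i < b -> g i ^+ p i = collect g i (q i)) ->
  (forall i, i < b -> g' i ^+ p i = collect g' i (q i)) ->
  (forall i l, i < b -> l < i -> g l ^ g i = collect g i (c i l)) ->
  (forall i l, i < b -> l < i -> g' l ^ g' i = collect g' i (c i l)) ->
  forall x, x \in tower (fun l => (g l, g' l)) b -> x.2 = 1 -> x.1 = 1.
Proof.
move=> Hp Hq Hq' Hc Hc'; set z := fun l => _.
have zX l n : z l ^+ n = (g l ^+ n, g' l ^+ n).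
  by elim: n => // n IHn; rewrite !expgS IHn.
elim: b Hp Hq Hq' Hc Hc' => [|b IHb] Hp Hq Hq' Hc Hc' x.
  have -> : tower z 0 = 1%G.
    apply/val_inj/trivgP; rewrite /= gen_subG; apply/subsetP => _ /imsetP[[]] //.
  by move/set1gP => ->.
(* The conjugation constants are common to both sequences, so the pairs themselves form a polycyclic
   sequence. *)
have nz : z b \in 'N(tower z b).
  rewrite inE /= -genJ gen_subG.
  apply/subsetP => _ /imsetP[_ /imsetP[l _ ->] ->].
  have -> : z l ^ z b = collect z b (c b l).
    by rewrite collect_pair -Hc // -Hc'.
  exact: collect_mem.
rewrite towerS norm_joinEr ?cycle_subG // => /mulsgP[h w hT /cycleP[t ->] ->] /=.
rewrite zX /= => h2.
have hT' : forall i (y : gT * gT'), y \in tower z i -> y.2 \in tower g' i.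
  move=> i y; have: tower z i \subset setX [set: gT] (tower g' i).
    by rewrite gen_subG; apply/subsetP => _ /imsetP[l _ ->]; rewrite !inE /= mem_tower.
  by move/subsetP => sub /sub; rewrite !inE.
(* A trivial second coordinate makes [t] a multiple of [p b]. The common power relation then moves
   [z b ^+ t], and with it the whole element, down to the previous tower. *)
have /Hp : g' b ^+ t \in tower g' b.
  rewrite (_ : _ ^+ t = h.2^-1) ?groupV ?(hT' _ _ hT) //.
  by apply/eqP; rewrite eq_sym eq_invg_mul h2.
move=> /(_ (ltnSn b)) /dvdnP[k Dt].
have zt : z b ^+ t \in tower z b.
  rewrite Dt mulnC expgM groupX // zX Hq // Hq' // -collect_pair collect_mem //.
have := IHb _ _ _ _ _ (h * z b ^+ t); rewrite /= zX /=; apply=> //.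
- by move=> i lti; apply: Hp; rewrite ltnW.
- by move=> i lti; apply: Hq; rewrite ltnW.
- by move=> i lti; apply: Hq'; rewrite ltnW.
- by move=> i l lti; apply: Hc; rewrite ltnW.
- by move=> i l lti; apply: Hc'; rewrite ltnW.
- by rewrite -zX groupM.
Qed.
End Tower.

(** * Encoding marked solvable groups by structure constants *)

Section Code.
Local Open Scope group_scope.
Variables b M d : nat.

(** The index type has [b.+1] elements rather than [b] so that [inord] applies even when [b = 0]. *)
Definition exponents : finType := {ffun 'I_b.+1 -> 'I_M.+1}.

(* The three summands index the powers [g i ^+ p i], the conjugates [g l ^ g i]
   and the marked elements [f k]. *)
Definition constants : finType :=
  {ffun ('I_b.+1 + 'I_b.+1 * 'I_b.+1 + 'I_d) -> exponents}.

Definition exponent (w : exponents) (l : nat) : nat := w (inord l).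

(** A polycyclic presentation with relative orders [p], together with the normal forms of the marked
    elements [f k]. *)
Definition has_constants (gT : finGroupType) (f : 'I_d -> gT) (p : exponents) (c : constants)
    (g : nat -> gT) : Prop :=
  [/\ forall i, i < b -> forall t, (g i ^+ t \in tower g i) = (exponent p i %| t),
      forall i, i < b ->
        g i ^+ exponent p i = collect g i (exponent (c (inl (inl (inord i))))),
      forall i l, i < b -> l < i ->
        g l ^ g i = collect g i (exponent (c (inl (inr (inord i, inord l))))) &
      forall k, f k = collect g b (exponent (c (inr k)))].

Lemma card_constants :
  #|{: exponents * constants}| =
  (M.+1 ^ (b.+1 * (b.+1 + b.+1 * b.+1 + d).+1))%N.
Proof.
by rewrite card_prod !card_ffun !card_sum card_prod !card_ord -expnM -expnD -mulnS.
Qed.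

Lemma exponentE (e : nat -> nat) :
  (forall l, e l <= M) -> exists w : exponents, forall l, l <= b -> exponent w l = e l.
Proof.
move=> le; exists [ffun l : 'I_b.+1 => inord (e l)] => l leb.
by rewrite /exponent ffunE inordK ?inordK // ltnS.
Qed.

Lemma eq_collect (gT : finGroupType) (g : nat -> gT) i e e' :
  (forall l, l < i -> e l = e' l) -> collect g i e = collect g i e'.
Proof. by move=> ee; apply: eq_bigr => l _; rewrite ee. Qed.

Lemma solvable_has_constants (gT : finGroupType) (f : 'I_d -> gT) (H : {group gT}) :
  solvable H -> #|H| <= 2 ^ b -> #|H| <= M -> (forall k, f k \in H) ->
  exists p c g, has_constants f p c g.
Proof.
move=> solH leb leM fH; have [g pg tg] := solvable_polycyclic solH leb.
have gH l : l < b -> g l \in H by move=> ltl; rewrite -tg mem_tower.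
have coll i x : i <= b -> x \in tower g i ->
    exists w : exponents, x = collect g i (exponent w).
  move=> leib; case/tower_collect => [l lti|e -> le].
    by rewrite pg ?(leq_trans lti).
  have [l|w ew] := @exponentE (fun l => if l < b then e l else 0).
    case: ifP => // ltl; rewrite (leq_trans (le l)) // (leq_trans _ leM) //.
    by rewrite subset_leq_card // cycle_subG gH.
  exists w; apply: eq_collect => l lti.
  by rewrite ew (leq_trans lti, leq_trans (ltnW lti)) // ?(leq_trans lti).
(* The order of [g i] modulo the preceding tower; the value 0 past [b] only serves the uniform bound
   by [M]. *)
pose o i := if i < b then #[coset (tower g i) (g i)] else 0.
have oE i t : i < b -> (g i ^+ t \in tower g i) = (o i %| t).
  move=> ltib; have nt := pg i ltib; rewrite /o ltib order_dvdn -morphX //.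
  apply/idP/eqP => [/coset_id //|]; exact: coset_idr (groupX _ nt).
have oM i : o i <= M.
  have [ltib|] := ltnP i b; last by rewrite /o ltnNge => ->.
  apply: (@leq_trans #[g i]); first apply: dvdn_leq => //.
    by rewrite -oE // expg_order.
  by rewrite (leq_trans _ leM) // subset_leq_card // cycle_subG gH.
(* Gathers the three kinds of constants into one predicate, so that a single finite choice produces
   all of them; out-of-range indices carry no condition. *)
pose good (j : 'I_b.+1 + 'I_b.+1 * 'I_b.+1 + 'I_d) (w : exponents) : Prop :=
  match j with
  | inl (inl i) => i < b -> g i ^+ o i = collect g i (exponent w)
  | inl (inr (i, l)) => i < b -> l < i -> g l ^ g i = collect g i (exponent w)
  | inr k => f k = collect g b (exponent w)
  end.
have [p ep] := exponentE oM.
have [|c cP] := @fin_all_exists _ (fun=> exponents) good.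
  case=> [[i|[i l]]|k] /=.
  - have [ltib|] := ltnP i b; last by exists [ffun=> ord0].
    by have [|w ->] := coll i (g i ^+ o i) (ltnW ltib); [rewrite oE | exists w].
  - have [ltib|] := ltnP i b; last by exists [ffun=> ord0].
    have [ltli|] := ltnP l i; last by exists [ffun=> ord0].
    have [|w ->] := coll i (g l ^ g i) (ltnW ltib); last by exists w.
    by rewrite memJ_norm ?pg // mem_tower.
  - by apply: coll => //; rewrite tg.
exists p, [ffun j => c j], g; split=> [i ltib t|i ltib|i l ltib ltli|k].
- by rewrite oE // ep // ltnW.
- have leib := ltnW ltib; have := cP (inl (inl (inord i))).
  by rewrite ffunE ep //= inordK // => ->.
- have leib := ltnW ltib; have lelb := ltnW (ltn_trans ltli ltib).
  have := cP (inl (inr (inord i, inord l))).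
  by rewrite ffunE /= !inordK // => ->.
- by rewrite ffunE (cP (inr k)).
Qed.

(** A code determines the marked elements up to isomorphism: [D] is the graph of the correspondence
    between the two polycyclic groups. *)
Lemma constants_graph (gT gT' : finGroupType) (f : 'I_d -> gT) (f' : 'I_d -> gT') p c g g' :
  has_constants f p c g -> has_constants f' p c g' ->
  exists D : {group gT * gT'}, (forall k, (f k, f' k) \in D) /\
    forall x, x \in D -> x.2 = 1 -> x.1 = 1.
Proof.
move=> [_ H2 H3 H4] [H1' H2' H3' H4'].
exists (tower (fun l => (g l, g' l)) b); split=> [k|].
  by rewrite H4 H4' -collect_pair collect_mem.
apply: (tower_graph _ H2 H2' H3 H3') => i ltib t.
by rewrite H1'.
Qed.
End Code.

From mathcomp Require Import all_classical all_reals all_analysis.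
From mathcomp Require Import zify ring lra.

Import Order.TTheory GRing.Theory Num.Theory.

(** * Word length and normal subgroups of finite index *)

Section Words.
Local Open Scope group_scope.
Variables (G : groupType) (X : set G).
Implicit Types (g h : G) (w : seq G).

Lemma is_word_cat w1 w2 : is_word X w1 -> is_word X w2 -> is_word X (w1 ++ w2).
Proof. by move=> h1 h2 x; rewrite mem_cat => /orP[/h1|/h2]. Qed.

Lemma word_inv w : is_word X w ->
  exists w', [/\ is_word X w', size w' = size w &
    \prod_(x <- w') x = (\prod_(x <- w) x)^-1].
Proof.
move=> wX; exists (rev (map (@invg G) w)); split.
- move=> x; rewrite mem_rev => /mapP[y /wX Xy ->].
  by rewrite invgK; case: Xy; [right|left].
- by rewrite size_rev size_map.
elim: w {wX} => [|x w IHw]; first by rewrite !big_nil invg1.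
by rewrite map_cons rev_cons -cats1 big_cat big_seq1 big_cons invgM IHw.
Qed.

Lemma word_length_le w : is_word X w -> word_length X (\prod_(x <- w) x) <= size w.
Proof.
move=> wX; rewrite /word_length.
set P := (P in least P); have P0 : P (size w) by exists w.
by have [_] := leastP (ex_intro P _ P0); apply.
Qed.

Hypothesis X_gen : generates X.

Lemma word_lengthP g :
  exists w, [/\ is_word X w, size w = word_length X g & \prod_(x <- w) x = g].
Proof.
suff [w [wX <-]] : exists w, is_word X w /\ \prod_(x <- w) x = g.
  rewrite /word_length; set P := (P in least P).
  have P0 : P (size w) by exists w.
  by have [[v [vX sv ev]] _] := leastP (ex_intro P _ P0); exists v.
pose H : set G := fun g => exists w, is_word X w /\ \prod_(x <- w) x = g.
suff : H g by [].
rewrite (X_gen (H := H)) //.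
  split=> [|x y [v [vX <-]] [w [wX <-]]|x [v [/word_inv[w [wX _ ew]] <-]]].
  - by exists [::]; rewrite big_nil; split.
  - by exists (v ++ w); rewrite big_cat; split=> //; exact: is_word_cat.
  - by exists w.
move=> x Xx; exists [:: x]; rewrite big_seq1; split=> // y; rewrite inE => /eqP->.
by left.
Qed.

Lemma word_length_mul g h : word_length X (g * h) <= word_length X g + word_length X h.
Proof.
have [v [vX <- {1}<-]] := word_lengthP g; have [w [wX <- {1}<-]] := word_lengthP h.
by rewrite -big_cat -size_cat word_length_le //; exact: is_word_cat.
Qed.

Lemma word_length_inv g : word_length X g^-1 <= word_length X g.
Proof.
have [v [vX <- {1}<-]] := word_lengthP g.
by have [w [wX <- <-]] := word_inv vX; exact: word_length_le.
Qed.

(** The commutator is [(a ^ q)^-1 * (a ^ q) ^ b], which uses [a] and [b] twice and [q] four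
    times. *)
Lemma word_length_conj_comm a b q :
  (word_length X [~ a ^ q, b] <=
   2 * word_length X a + 4 * word_length X q + 2 * word_length X b)%N.
Proof.
have conj g h : (word_length X (g ^ h) <= word_length X g + 2 * word_length X h)%N.
  rewrite conjgE (leq_trans (word_length_mul _ _)) //.
  have := word_length_mul g h; have := word_length_inv h.
  do 4![move: (word_length X _) => ?]; lia.
rewrite commgEl.
have := word_length_mul (a ^ q)^-1 ((a ^ q) ^ b).
have := word_length_inv (a ^ q); have := conj a q; have := conj (a ^ q) b.
do 7![move: (word_length X _) => ?]; lia.
Qed.

Lemma word_ind (P : G -> Prop) :
  P 1 -> (forall g x, X x \/ X x^-1 -> P g -> P (g * x)) -> forall g, P g.
Proof.
move=> P1 PM g; have [w [wX _ <-]] := word_lengthP g.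
elim/last_ind: w wX => [_|w x IHw wX]; first by rewrite big_nil.
rewrite big_rcons; apply: PM; first by apply: wX; rewrite mem_rcons mem_head.
by apply: IHw => y yw; apply: wX; rewrite mem_rcons inE yw orbT.
Qed.

Lemma finite_ball n : finite_set X -> finite_set [set g | (word_length X g <= n)%N]%classic.
Proof.
move=> finX; pose S := (X `|` [set x^-1 | x in X] `|` [set 1])%classic.
have finS : finite_set S by rewrite !finite_setU; split; [split=> //; exact: finite_image|].
suff fin : finite_set [set g | exists w, [/\ is_word X w, size w <= n & \prod_(x <- w) x = g]]%classic.
  apply: sub_finite_set fin => g /= len.
  by have [w [wX sw ew]] := word_lengthP g; exists w; rewrite sw.
elim: n => [|n IHn].
  apply: (@sub_finite_set _ _ [set 1]%classic) => // g /= [[|x w] [_ //= _ <-]].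
  by rewrite big_nil.
apply: sub_finite_set (finite_image2 (fun x y => x * y) finS IHn) => g /= [[|x w] [wX sw <-]].
  exists 1; first by right.
  by exists 1; [exists [::]; rewrite big_nil; split|rewrite big_nil mulg1].
exists x.
  left; case: (wX x (mem_head _ _)); first by left.
  by right; exists x^-1 => //; rewrite invgK.
exists (\prod_(x <- w) x); last by rewrite big_cons.
by exists w; split=> // y yw; apply: wX; rewrite inE yw orbT.
Qed.
End Words.

(** * Coset labels and the Cayley representation *)

Section Index.
Local Open Scope group_scope.
Variable G : groupType.
Implicit Types H K : set G.

(** Stands in for the quotient map to [G / H]. As [f] need not be onto, it only bounds the index of
    [H] by the size of [T]. *)
Definition labels_cosets (T : Type) H (f : G -> T) : Prop :=
  forall x y, f x = f y <-> H (x * y^-1).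

Lemma normal_mulC H x y : is_normal_subgroup H -> H (x * y) -> H (y * x).
Proof. by move=> [_ nH] /(nH _ x); rewrite conjgE -mulgA mulKg. Qed.

Lemma left_cosets_label H N :
  is_normal_subgroup H -> (left_cosets H #<= `I_N)%card ->
  exists f : G -> 'I_N, labels_cosets H f.
Proof.
move=> nH; have [[H1 HM HV] _] := nH; case/ppcard_leP => F.
pose cos x : set G := [set x * h | h in H]%classic.
have cosP x : left_cosets H (cos x) by exists x.
have Flt x : F (cos x) < N.
  by have := @funS _ _ _ _ F (cos x) (cosP x).
exists (fun x => Ordinal (Flt x)) => x y.
have -> : Ordinal (Flt x) = Ordinal (Flt y) <-> cos x = cos y.
  split=> [[] |cxy]; last by apply: val_inj; rewrite /= cxy.
  by apply: (inj (f := F)); rewrite inE; exact: cosP.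
split=> [cxy|Hxy].
  have [h Hh e] : cos x y by rewrite cxy; exists 1 => //; rewrite mulg1.
  by apply: normal_mulC => //; rewrite -e invgM mulgKV; exact: HV.
have Hyx : H (y^-1 * x) by exact: normal_mulC.
rewrite eqEsubset; split=> _ [h Hh <-].
  by exists (y^-1 * x * h); [exact: HM | rewrite !mulgA mulgV mul1g].
exists (x^-1 * y * h); last by rewrite !mulgA mulgV mul1g.
by apply: HM => //; rewrite -(invgK (x^-1 * y)) invgM invgK; exact: HV.
Qed.

(** [G] acts on labels by right multiplication of cosets, and labels of no coset are fixed. All
    quotients of order at most [N] thus live in the one group ['S_N]. *)
Lemma cayley H N (f : G -> 'I_N) :
  is_normal_subgroup H -> labels_cosets H f ->
  exists2 phi : G -> 'S_N, {morph phi : x y / x * y} & forall g, phi g = 1 <-> H g.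
Proof.
move=> nH fP; have [[H1 HM HV] nHJ] := nH.
pose act g i := if pselect (exists x, f x = i) is left e then f (projT1 (cid e) * g) else i.
have actE g x : act g (f x) = f (x * g).
  rewrite /act; case: pselect => [e|[]]; last by exists x.
  case: cid => y /= /fP Hyx; apply/fP.
  by rewrite invgM mulgA mulgK.
have actN g i : ~ (exists x, f x = i) -> act g i = i by rewrite /act; case: pselect.
have actM g h i : act h (act g i) = act (g * h) i.
  have [[x <-]|ni] := pselect (exists x, f x = i); last by rewrite !actN.
  by rewrite !actE mulgA.
have act1 i : act 1 i = i.
  have [[x <-]|ni] := pselect (exists x, f x = i); last by rewrite actN.
  by rewrite actE mulg1.
have actI g : injective (act g).
  by apply: (can_inj (g := act g^-1)) => i; rewrite actM mulgV act1.
exists (fun g => perm (@actI g)) => [x y|g].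
  by apply/permP => i; rewrite permM !permE actM.
split=> [/permP/(_ (f 1))|Hg].
  by rewrite permE perm1 actE mul1g => /fP; rewrite invg1 mulg1.
apply/permP => i; rewrite permE perm1.
have [[x <-]|ni] := pselect (exists x, f x = i); last by rewrite actN.
rewrite actE; apply/fP; rewrite (_ : _ * _ = g ^ x^-1); first exact: nHJ.
by rewrite conjgE invgK mulgA.
Qed.
End Index.

(** * Homomorphisms to finite groups, short representatives, nested commutators *)

Section Morphisms.
Local Open Scope group_scope.
Variables (G : groupType) (gT : finGroupType) (phi : G -> gT).
Hypothesis phiM : {morph phi : x y / x * y}.

Lemma morph_one : phi 1 = 1.
Proof. by apply: (mulgI (phi 1)); rewrite -phiM !mulg1. Qed.

Lemma morph_inv x : phi x^-1 = (phi x)^-1.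
Proof. by apply: (mulgI (phi x)); rewrite -phiM !mulgV morph_one. Qed.

Lemma morph_comm x y : phi [~ x, y] = [~ phi x, phi y].
Proof. by rewrite !commgEl !conjgE !(phiM, morph_inv). Qed.

Lemma morph_conj x y : phi (x ^ y) = phi x ^ phi y.
Proof. by rewrite !conjgE !(phiM, morph_inv). Qed.

Lemma morph_eq x y : phi x = phi y <-> phi (x * y^-1) = 1.
Proof.
rewrite phiM morph_inv; split=> [->|e]; first by rewrite mulgV.
by rewrite -[phi x](mulgKV (phi y)) e mul1g.
Qed.

Lemma kernel_normal : is_normal_subgroup [set g | phi g = 1]%classic.
Proof.
split; first split=> /= [|x y ex ey|x ex].
- exact: morph_one.
- by rewrite phiM ex ey mulg1.
- by rewrite morph_inv ex invg1.
by move=> x y /= ex; rewrite morph_conj ex conj1g.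
Qed.

Lemma image_group (H : set G) : is_subgroup H ->
  exists D : {group gT}, forall z, z \in D <-> exists2 g, H g & phi g = z.
Proof.
move=> [H1 HM HV].
pose S : {set gT} := finset (fun z => `[< exists2 g, H g & phi g = z >]).
have SE z : z \in S <-> exists2 g, H g & phi g = z.
  by rewrite inE; split=> [/asboolP|h] //; apply/asboolP.
suff gS : group_set S by exists (group gS).
apply/group_setP; split; first by apply/SE; exists 1; rewrite ?morph_one.
move=> _ _ /SE[g Hg <-] /SE[h Hh <-]; apply/SE.
by exists (g * h); [exact: HM|rewrite phiM].
Qed.

Lemma kernel_label (D : {group gT}) N : (forall g, phi g \in D) -> #|D| <= N ->
  exists f : G -> 'I_N, labels_cosets [set g | phi g = 1]%classic f.
Proof.
move=> phiD leN.
have lt g : index (phi g) (enum D) < N.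
  by rewrite (leq_trans _ leN) // cardE index_mem mem_enum.
exists (fun g => Ordinal (lt g)) => x y; split=> [[] e|/morph_eq e] /=.
  by apply/morph_eq; rewrite -(nth_index 1 (x := phi x) (s := enum D)) ?mem_enum // e nth_index ?mem_enum.
by apply: val_inj; rewrite /= e.
Qed.

Variable X : set G.
Hypothesis X_gen : generates X.

(** A path without repeated vertices in the Cayley graph of the image has fewer than [#|D|] edges,
    and its edge labels spell the representative. *)
Lemma short_representative (D : {group gT}) g : (forall g, phi g \in D) ->
  exists2 h, phi h = phi g & word_length X h <= #|D|.
Proof.
move=> phiD.
pose e (x y : gT) := `[< exists2 a, X a \/ X a^-1 & y = x * phi a >].
have conn : connect e 1 (phi g).
  apply: (word_ind X_gen (P := fun g => connect e 1 (phi g))) => [|h a Xa ch].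
    by rewrite morph_one connect0.
  by apply: (connect_trans ch); apply: connect1; apply/asboolP; exists a.
case/connectP: conn => p0 /shortenP[p pe up _ ->] {p0}.
(* The prefix [q] lets the starting vertex vary in the induction on the path. *)
suff [w [wX sw ew]] : exists w, [/\ is_word X w, size w = size p &
    forall q, phi q = 1 -> phi (q * \prod_(x <- w) x) = last 1 p].
  exists (\prod_(x <- w) x); first by rewrite -(ew 1 morph_one) mul1g.
  rewrite (leq_trans (word_length_le wX)) // sw.
  have sub : {subset 1 :: p <= D}.
    move=> x; rewrite inE => /predU1P[->|]; first exact: group1.
    have : 1 \in D by [].
    elim: p (1 : gT) pe {up sw ew} => //= y p IHp z /andP[/asboolP[a _ ->] pp] zD.
    have zaD : z * phi a \in D by rewrite groupM.
    by rewrite inE => /predU1P[->//|]; exact: IHp pp zaD.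
  by rewrite ltnW // -[(size p).+1]/(size (1 :: p)) cardE uniq_leq_size // => x /sub; rewrite mem_enum.
elim: p (1 : gT) pe {up} => /= [|y p IHp] z; first by exists [::]; split=> // q; rewrite big_nil mulg1.
case/andP=> /asboolP[a Xa ->] /IHp[w [wX sw ew]].
exists (a :: w); split; rewrite /= ?sw //.
  by move=> x; rewrite inE => /predU1P[->|/wX].
by move=> q eq; rewrite big_cons mulgA ew // phiM eq.
Qed.

(* Balanced nested commutators: the word length only grows polynomially in the
   number of entries. *)
Lemma nested_commutator L l k (s : seq G) :
  (forall a b, phi a <> 1 -> phi b <> 1 ->
     exists2 q, word_length X q <= L & phi [~ a ^ q, b] <> 1) ->
  s != [::] -> size s <= 2 ^ k ->
  (forall x, x \in s -> phi x <> 1 /\ word_length X x <= l) ->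
  exists u, [/\ phi u <> 1, (word_length X u + 2 * L <= 4 ^ k * (l + 2 * L))%N &
    forall H : set G, is_normal_subgroup H -> (exists2 x, x \in s & H x) -> H u].
Proof.
move=> prim; elim: k s => [|k IHk] s sn0 ss sP.
  case: s sn0 ss sP => [//|x [|//]] _ _ /(_ x (mem_head _ _))[nx lx].
  exists x; split=> //; first by rewrite expn0 mul1n leq_add2r.
  by move=> H _ [y]; rewrite inE => /eqP->.
have [sk|sk] := leqP (size s) (2 ^ k).
  have [u [nu lu uH]] := IHk s sn0 sk sP; exists u; split=> //.
  by rewrite (leq_trans lu) // leq_mul2r leq_exp2l ?leqnSn ?orbT.
have [||x /mem_take /sP //|u [nu lu uH]] := IHk (take (2 ^ k) s).
- by rewrite -size_eq0 size_takel ?expn_eq0 // ltnW.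
- by rewrite size_takel // ltnW.
have [||x /mem_drop /sP //|v [nv lv vH]] := IHk (drop (2 ^ k) s).
- by rewrite -size_eq0 size_drop subn_eq0 -ltnNge.
- by rewrite size_drop leq_subLR addnn -mul2n -expnS.
have [q lq nq] := prim u v nu nv.
exists [~ u ^ q, v]; split=> // [|H nH [x]].
  (* The summand [2 * L] absorbs the cost of [q]: lengths at most [m] give at most [4 m + 4 L], and
     [4 m + 6 L] is at most [4 (m + 2 L)]. *)
  have := word_length_conj_comm X_gen u v q; rewrite expnS -mulnA.
  move: (4 ^ k * _)%N lu lv lq => B; do 4![move: (word_length X _) => ?]; lia.
rewrite -(cat_take_drop (2 ^ k) s) mem_cat => xs Hx.
have [[H1 HM HV] HJ] := nH.
case/orP: xs => [xs|xs].
  have Hu : H u by apply: uH => //; exists x.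
  by rewrite commgEl; apply: HM; [apply: HV|do 1!apply: (HJ)]; apply: HJ.
have Hv : H v by apply: vH => //; exists x.
by rewrite commgEr; apply: HM => //; apply: (HJ); apply: HV.
Qed.
End Morphisms.

(** * Prime quotients *)

Lemma poly_lt_exp A k : exists j0, forall j, j0 < j -> (A * j ^ k < 2 ^ j)%N.
Proof.
(* Here [j] is less than [k.+1 * (j %/ k.+1).+1], hence at most [k.+1 * 2 ^ (j %/ k.+1)]; the claim
   is the [k.+1]-st power of this. *)
have bnd : forall j, (j ^ k.+1 <= k.+1 ^ k.+1 * 2 ^ j)%N.
  move=> j; apply: (@leq_trans ((k.+1 * 2 ^ (j %/ k.+1)) ^ k.+1)%N).
    rewrite leq_exp2r // ltnW // (leq_trans (ltn_ceil j (ltn0Sn k))) // mulnC.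
    by rewrite leq_mul2l ltn_expl.
  by rewrite expnMn leq_mul2l -expnM leq_exp2l // leq_divM orbT.
exists (A * k.+1 ^ k.+1)%N => j ltj.
have j0 : 0 < j by apply: leq_ltn_trans ltj.
rewrite -(@ltn_pmul2l (k.+1 ^ k.+1)) ?expn_gt0 // (leq_trans _ (bnd j)) //.
by rewrite mulnA (mulnC _ A) (expnS j) ltn_pmul2r // expn_gt0 j0.
Qed.

Section Residual.
Local Open Scope group_scope.
Variables (G : groupType) (X : set G).
Hypothesis X_gen : generates X.

Definition prime_morphism (gT : finGroupType) (phi : G -> gT) : Prop :=
  forall a b, phi a <> 1 -> phi b <> 1 -> exists q, phi [~ a ^ q, b] <> 1.

Lemma prime_quotient_detect (gT : finGroupType) (phi : G -> gT) (D : {group gT}) j N :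
  {morph phi : x y / x * y} -> (forall z, z \in D <-> exists g, phi g = z) ->
  prime_morphism phi -> 1 < #|D| <= 2 ^ j ->
  detects X (2 ^ (5 * j + 2)) N -> #|D| <= N.
Proof.
move=> phiM DP prim /andP[D1 Dj] det; set m := #|D| in D1 Dj *.
have phiD g : phi g \in D by apply/DP; exists g.
have /choice[r rP] : forall z, exists h, z \in D -> phi h = z /\ word_length X h <= m.
  move=> z.
  have [zD|] := boolP (z \in D); last by exists 1.
  have [g eg] := (DP z).1 zD.
  by have [h eh lh] := short_representative phiM X_gen g phiD; exists h; rewrite eh eg.
pose s := [seq r p.1 * (r p.2)^-1 | p <- enum (finset.setX D D) & p.1 != p.2].
have sE a b : a \in D -> b \in D -> a != b -> r a * (r b)^-1 \in s.
  move=> aD bD nab; apply/mapP; exists (a, b) => //.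
  by rewrite mem_filter nab mem_enum inE /= aD.
(* There are at most [m ^ 2], so at most [2 ^ (2 * j)], differences, each of length at most [2 * m].
   The commutator has length at most [4 ^ (2 * j) * (4 * m)], which is at most [2 ^ (5 * j + 2)]. *)
have [|||x|u [nu lu uH]] := @nested_commutator _ _ phi X X_gen m (2 * m)%N (2 * j) s.
- move=> a b na nb; have [q nq] := prim a b na nb.
  have [h eh lh] := short_representative phiM X_gen q phiD; exists h => //.
  by move: nq; rewrite !(morph_comm phiM, morph_conj phiM) eh.
- have [z zD zn] : exists2 z, z \in D & z != 1.
    have : ~~ (D \subset [1]) by rewrite subG1 trivg_card1 gtn_eqF.
    by case/subsetPn => z zD; rewrite inE => zn; exists z.
  by apply/eqP => s0; have := sE z 1 zD (group1 D) zn; rewrite s0.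
- rewrite size_map size_filter (leq_trans (count_size _ _)) // -cardE finset.cardsX.
  by rewrite mulnC expnM -mulnn leq_mul.
- case/mapP=> -[a b]; rewrite mem_filter mem_enum inE /= => /andP[nab /andP[aD bD]] ->.
  have [ea la] := rP a aD; have [eb lb] := rP b bD; split.
    by move/(morph_eq phiM); rewrite ea eb; apply/eqP.
  rewrite (leq_trans (word_length_mul X_gen _ _)) // mul2n -addnn leq_add //.
  exact: leq_trans (word_length_inv X_gen _) lb.
have u1 : u <> 1 by move=> u1; apply: nu; rewrite u1 morph_one.
have lu' : word_length X u <= 2 ^ (5 * j + 2).
  have : (4 ^ (2 * j) * (2 * m + 2 * m) <= 2 ^ (5 * j + 2))%N.
    rewrite (_ : (2 ^ (5 * j + 2) = 4 ^ (2 * j) * (2 ^ j * 4))%N).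
      rewrite leq_mul2l; apply/orP; right; move: (2 ^ j)%N Dj => J; lia.
    by rewrite -[4]/(2 ^ 2)%N -!expnM -!expnD; congr (_ ^ _)%N; lia.
  by move=> h; apply: leq_trans (leq_trans lu h); exact: leq_addr.
have [H [nH HN nHu]] := det u u1 lu'.
have [f fP] := left_cosets_label nH HN.
rewrite leqNgt; apply/negP => ltN; apply: nHu; apply: uH => //.
(* Pigeonhole: with fewer than [#|D|] cosets, two representatives share one. *)
have [/dinjectiveP inj|] := boolP (dinjectiveb (f \o r) D).
  move: ltN; rewrite /m -(card_in_imset inj) ltnNge => /negP[].
  by rewrite (leq_trans (max_card _)) // card_ord.
case/dinjectivePn => a aD [b]; rewrite inE /= => /andP[nba bD] /fP Hab.
by exists (r a * (r b)^-1) => //; apply: sE => //; rewrite eq_sym.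
Qed.

Variables K k : nat.
Hypothesis det : forall t, 1 < t -> detects X (2 ^ t) (K * t ^ k).

Lemma prime_quotient_bounded : exists N0, forall (gT : finGroupType) (phi : G -> gT) (D : {group gT}),
  {morph phi : x y / x * y} -> (forall z, z \in D <-> exists g, phi g = z) ->
  prime_morphism phi -> #|D| <= N0.
Proof.
(* With [j] the rounded-up logarithm of [#|D|], the factor 2 comes from [2 ^ j.-1 < #|D|] and
   [7 ^ k] from bounding [5 * j + 2] by [7 * j]. *)
have [j0 j0P] := poly_lt_exp (2 * (K * 7 ^ k)) k.
exists (2 ^ j0)%N => gT phi D phiM DP prim; rewrite leqNgt; apply/negP => ltD.
have D1 : 1 < #|D| by rewrite (leq_ltn_trans _ ltD) // expn_gt0.
have /andP[lo hi] := up_log_bounds (ltnSn 1) D1; set j := up_log 2 #|D| in lo hi.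
have ltj : j0 < j by rewrite -(@ltn_exp2l 2) // (leq_trans ltD).
have t1 : (1 < 5 * j + 2)%N by rewrite addn2.
have := @prime_quotient_detect _ phi D j (K * (5 * j + 2) ^ k) phiM DP prim.
rewrite D1 hi => /(_ isT (det t1)); apply/negP; rewrite -ltnNge (leq_ltn_trans _ lo) //.
rewrite -(@leq_pmul2l 2) // -expnS prednK ?(leq_ltn_trans _ ltj) // ltnW //.
apply: leq_ltn_trans (j0P j ltj); rewrite -!mulnA -expnMn !leq_mul //.
by case: (k) => // k'; rewrite leq_exp2r //; lia.
Qed.
End Residual.

(** * Counting the restricted kernels *)

Section Core.
Local Open Scope group_scope.
Variables (G : groupType) (X : set G).
Hypotheses (X_gen : generates X) (X_fin : finite_set X).
Variable N : nat.

(** By Cayley's theorem this lies in every normal subgroup of index at most [N]. Using homomorphisms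
    to one fixed finite group makes finiteness of the index a matter of counting them. *)
Definition core : set G :=
  [set g | forall psi : G -> 'S_N, {morph psi : x y / x * y} -> psi g = 1]%classic.

Lemma core_normal : is_normal_subgroup core.
Proof.
split; first split=> /= [|x y ex ey|x ex] psi psiM.
- exact: morph_one.
- by rewrite psiM ex // ey // mulg1.
- by rewrite morph_inv // ex // invg1.
by move=> x y /= ex psi psiM; rewrite morph_conj // ex // conj1g.
Qed.

Lemma morph_eq_on_generators (gT : finGroupType) (phi psi : G -> gT) :
  {morph phi : x y / x * y} -> {morph psi : x y / x * y} ->
  (forall x, X x -> phi x = psi x) -> phi =1 psi.
Proof.
move=> phiM psiM e g.
suff e' : [set g | phi g = psi g]%classic = [set: G]%classic.
  by have : [set: G]%classic g by []; rewrite -e'.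
apply: X_gen => //; split=> /= [|x y ex ey|x ex].
- by rewrite (morph_one phiM) (morph_one psiM).
- by rewrite phiM psiM ex ey.
- by rewrite (morph_inv phiM) (morph_inv psiM) ex.
Qed.

Lemma core_label : exists (T : finType) (f : G -> T), labels_cosets core f.
Proof.
have [s sX] := (finite_seqP X).1 X_fin.
pose V : finType := {ffun 'I_(size s) -> 'S_N}.
(* A homomorphism is determined by its values [v] on the generators, so [E] enumerates all of them;
   where no homomorphism has values [v], the trivial one is a harmless default. *)
have /choice[E EP] : forall v : V, exists phi : G -> 'S_N, {morph phi : x y / x * y} /\
    forall psi : G -> 'S_N, {morph psi : x y / x * y} ->
      (forall i : 'I_(size s), psi (nth 1 s i) = v i) -> psi =1 phi.
  move=> v.
  have [[phi [phiM e]]|no] := pselect (exists phi : G -> 'S_N,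
      {morph phi : x y / x * y} /\ forall i : 'I_(size s), phi (nth 1 s i) = v i).
    exists phi; split=> // psi psiM e'; apply: morph_eq_on_generators => // x.
    rewrite sX /= => xs; have lt : index x s < size s by rewrite index_mem.
    by have := e (Ordinal lt); have := e' (Ordinal lt); rewrite /= nth_index // => -> ->.
  exists (fun=> 1); split=> [x y|psi psiM e]; first by rewrite mulg1.
  by case: no; exists psi.
exists {ffun V -> 'S_N}, (fun g => [ffun v => E v g]) => x y.
split=> [/ffunP e psi psiM|e].
  pose v : V := [ffun i : 'I_(size s) => psi (nth 1 s i)].
  have [EM e'] := EP v; rewrite (e' psi psiM) => [|i]; last by rewrite ffunE.
  by apply/(morph_eq EM); have := e v; rewrite !ffunE.
apply/ffunP => v; rewrite !ffunE; have [EM _] := EP v.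
by apply/(morph_eq EM); apply: e.
Qed.

(** Schreier's lemma, with transversal [t]. *)
Lemma finite_index_generated (T : finType) (H : set G) (f : G -> T) :
  is_normal_subgroup H -> labels_cosets H f ->
  exists Y : seq G, (forall y, y \in Y -> H y) /\
    forall S : set G, is_subgroup S -> (forall y, y \in Y -> S y) -> (H `<=` S)%classic.
Proof.
move=> nH fP; have [s sX] := (finite_seqP X).1 X_fin.
have /choice[t tP] : forall i, exists g, (exists h, f h = i) -> f g = i.
  move=> i; have [[h e]|no] := pselect (exists h, f h = i); first by exists h.
  by exists 1.
have tf g : f (t (f g)) = f g by apply: tP; exists g.
(* Schreier generators for [X] and its inverses. The representative [t (f 1)] of [H] itself may be
   nontrivial, so it is added. *)
pose Y := t (f 1) :: [seq t p.1 * p.2 * (t (f (t p.1 * p.2)))^-1 |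
  p <- [seq (i, x) | i <- enum T, x <- s ++ map (@invg G) s]].
exists Y; split=> [y|S [S1 SM SV] SY g Hg].
  rewrite inE => /predU1P[->|/mapP[[i x] _ ->]]; last by apply/fP; rewrite /= tf.
  move: (@fP (t (f 1)) 1); rewrite invg1 mulg1 tf => -[h _]; exact: h.
have St : S (t (f 1)) by apply: SY; exact: mem_head.
have key : forall h, S (h * (t (f h))^-1).
  apply: (word_ind X_gen).
    by rewrite mul1g; apply: SV.
  move=> h x Xx Sh.
  have e : f (h * x) = f (t (f h) * x).
    apply/fP; rewrite invgM mulgA mulgK; apply/fP; by rewrite tf.
  have Sy : S (t (f h) * x * (t (f (h * x)))^-1).
    rewrite e; apply: SY; rewrite inE; apply/orP; right; apply/mapP; exists (f h, x) => //.
    apply/allpairsP; exists (f h, x); split=> //=; first by rewrite mem_enum.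
    rewrite mem_cat; case: Xx; rewrite sX /= => xs; apply/orP; first by left.
    by right; apply/mapP; exists x^-1; rewrite ?invgK.
  rewrite (_ : _ * _ = h * (t (f h))^-1 * (t (f h) * x * (t (f (h * x)))^-1)).
    exact: SM.
  by rewrite !mulgA mulgKV.
have e : f g = f 1 by apply/fP; rewrite invg1 mulg1.
by rewrite -(mulgKV (t (f g)) g) {2}e; apply: SM.
Qed.
End Core.

(** * Codes for kernels restricted to the core, and the ball bound *)

Section Bound.
Local Open Scope group_scope.
Variables (G : groupType) (X : set G) (N0 : nat).
Hypotheses (X_gen : generates X) (X_fin : finite_set X).
Hypothesis prime_bound : forall (gT : finGroupType) (phi : G -> gT) (D : {group gT}),
  {morph phi : x y / x * y} -> (forall z, z \in D <-> exists g, phi g = z) ->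
  prime_morphism phi -> #|D| <= N0.

Lemma core_prime_quotient (gT : finGroupType) (phi : G -> gT) (D : {group gT}) g :
  {morph phi : x y / x * y} -> (forall z, z \in D <-> exists g, phi g = z) ->
  prime_morphism phi -> core N0 g -> phi g = 1.
Proof.
move=> phiM DP prim cg.
have [|f fP] := kernel_label phiM _ (prime_bound phiM DP prim).
  by move=> h; apply/DP; exists h.
have [psi psiM psiK] := cayley (kernel_normal phiM) fP.
by apply: (psiK g).1; exact: cg.
Qed.

(** Each prime quotient of the finite image is a prime quotient of [G], so it kills the core;
    [solvable_sub_primes] then applies. *)
Lemma solvable_core_image (gT : finGroupType) (phi : G -> gT) (I : {group gT}) :
  {morph phi : x y / x * y} ->
  (forall z, z \in I <-> exists2 g, core N0 g & phi g = z) -> solvable I.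
Proof.
move=> phiM IP.
have [|Q QP'] := image_group phiM (H := [set: G]%classic); first by split.
have QP z : z \in Q <-> exists g, phi g = z.
  by rewrite QP'; split=> [[g _ <-]|[g <-]]; exists g.
have phiQ g : phi g \in Q by apply/QP; exists g.
have nIQ : normal I Q.
  apply/andP; split; first by apply/fintype.subsetP => z /IP[g _ <-].
  apply/fintype.subsetP => z /QP[h <-]; rewrite inE; apply/fintype.subsetP => _ /imsetP[_ /IP[g cg <-] ->].
  apply/IP; exists (g ^ h); last exact: morph_conj.
  by have [_] := core_normal G N0; apply.
apply: (solvable_sub_primes nIQ) => C [nCQ prC]; apply/fintype.subsetP => _ /IP[g cg <-].
have phiN h : phi h \in 'N(C) by rewrite (fintype.subsetP (normal_norm nCQ)).
pose psi h := coset C (phi h).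
have psiM : {morph psi : x y / x * y} by move=> x y; rewrite /psi phiM morphM.
have psi1 h : psi h = 1 <-> phi h \in C.
  by split=> [/(coset_idr (phiN h))|/coset_id].
apply/psi1; apply: (core_prime_quotient (D := (Q / C)%G)) => // [z|a b na nb].
  split=> [/morphimP[x _ /QP[h <-] ->]|[h <-]]; first by exists h.
  by apply: mem_quotient.
have [//|//|||_ /QP[q' <-] nq] := prC (phi a) (phi b).
- by apply/negP => aC; apply: na; apply/psi1.
- by apply/negP => bC; apply: nb; apply/psi1.
by exists q' => e; move/negP: nq; apply; rewrite -(morph_conj phiM) -(morph_comm phiM); apply/psi1.
Qed.

Lemma card_image_label (gT : finGroupType) (phi : G -> gT) N (H : set G) (f : G -> 'I_N)
    (D : {group gT}) :
  {morph phi : x y / x * y} -> (forall g, phi g = 1 <-> H g) -> labels_cosets H f ->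
  (forall z, z \in D -> exists g, phi g = z) -> #|D| <= N.
Proof.
move=> phiM phiK fP DP.
have /choice[r rP] : forall z, exists g, z \in D -> phi g = z.
  move=> z; have [/DP[g eg]|] := boolP (z \in D); first by exists g.
  by exists 1.
have inj : {in D &, injective (f \o r)}.
  move=> a b aD bD /fP/phiK/(morph_eq phiM); rewrite rP // rP //.
by rewrite -(card_in_imset inj) (leq_trans (max_card _)) // card_ord.
Qed.

(** A code records the images of finitely many generators of the core, whose number [d] does not
    depend on [N]. Kernels with a common code agree on the core. [R] is a relation since a kernel
    may have many codes. *)
Lemma kernels_encoded : exists d, forall N b, N <= 2 ^ b ->
  exists R : set G -> exponents b N * constants b N d -> Prop,
    (forall H, is_normal_subgroup H -> (left_cosets H #<= `I_N)%card -> exists c, R H c) /\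
    (forall H H' c, R H c -> R H' c -> forall g, core N0 g -> H' g -> H g).
Proof.
have [T [f fP]] := core_label X_gen X_fin N0.
have [Y [Ycore Ygen]] := finite_index_generated X_gen X_fin (core_normal G N0) fP.
exists (size Y) => N b leN.
pose R (H : set G) (c : exponents b N * constants b N (size Y)) :=
  exists phi : G -> 'S_N, [/\ {morph phi : x y / x * y},
    forall g, phi g = 1 <-> H g &
    exists u, has_constants (fun i : 'I_(size Y) => phi (nth 1 Y i)) c.1 c.2 u].
exists R; split=> [H nH HN|H H' c].
  have [h hP] := left_cosets_label nH HN.
  have [phi phiM phiK] := cayley nH hP.
  have [I IP] := image_group phiM (core_normal G N0).1.
  have leI : #|I| <= N by apply: (card_image_label phiM phiK hP) => z /IP[g _ <-]; exists g.
  have [||p [c [u uP]]] := solvable_has_constants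
      (b := b) (f := fun i : 'I_(size Y) => phi (nth 1 Y i)) (solvable_core_image phiM IP) _ leI.
  - exact: leq_trans leI leN.
  - by move=> i; apply/IP; exists (nth 1 Y i) => //; apply: Ycore; exact: mem_nth.
  by exists (p, c), phi; split=> //; exists u.
move=> [phi [phiM phiK [u uP]]] [phi' [phiM' phiK' [u' uP']]] g cg /phiK' g1.
have [D [DY D1]] := constants_graph uP uP'.
apply/phiK; apply: (D1 (phi g, phi' g)) => //.
(* The elements whose pair of images lies in the graph [D] form a subgroup containing [Y], hence the
   core. *)
apply: (Ygen [set g | (phi g, phi' g) \in D]%classic) => // [|y yY] /=.
  split=> /= [|x y xD yD|x xD].
  - by rewrite (morph_one phiM) (morph_one phiM') group1.
  - by rewrite phiM phiM' (groupM xD yD).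
  - by rewrite (morph_inv phiM) (morph_inv phiM') (groupVr xD).
have lt : index y Y < size Y by rewrite index_mem.
by have := DY (Ordinal lt); rewrite /= nth_index.
Qed.

Lemma ball_bound : exists B d, forall t N b n,
  detects X (2 ^ t.+1) N -> N <= 2 ^ b -> n <= 2 ^ t ->
  word_growth X n <= B * N.+1 ^ (N.+1 ^ (b.+1 * (b.+1 + b.+1 * b.+1 + d).+1)).
Proof.
have [T [f fP]] := core_label X_gen X_fin N0.
have [d dP] := kernels_encoded; exists #|T|, d => t N b n det leN len.
have [R [Rex Rsame]] := dP N b leN.
(* One labelling per code separates points of a core coset modulo every kernel with that code. The
   type ['I_N.+1] leaves a default label for codes of no kernel. *)
have /choice[F FP] : forall c, exists F : G -> 'I_N.+1, forall H x y,
    is_normal_subgroup H -> (left_cosets H #<= `I_N)%card -> R H c ->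
    core N0 (x * y^-1) -> F x = F y -> H (x * y^-1).
  move=> c; have [[H [nH HN RH]]|no] := pselect (exists H,
      [/\ is_normal_subgroup H, (left_cosets H #<= `I_N)%card & R H c]).
    have [h hP] := left_cosets_label nH HN.
    exists (fun g => widen_ord (leqnSn N) (h g)) => H' x y _ _ RH' cxy.
    move/(congr1 (@nat_of_ord _)) => /= /ord_inj/hP; exact: Rsame RH' RH _ cxy.
  by exists (fun=> ord0) => H x y nH HN RH; case: no; exists H.
pose P : finType := (T * {ffun exponents b N * constants b N d -> 'I_N.+1})%type.
(* Injective on the ball: for distinct [x] and [y] in it, [x * y^-1] has length at most [2 ^ t.+1],
   so some detecting [H] excludes it, and a code of [H] tells them apart within a core coset. *)
pose Phi g : P := (f g, [ffun c => F c g]).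
rewrite -card_constants -[X in (_ * X ^ #|_|)%N](card_ord N.+1) -card_ffun -card_prod.
apply: geq_card_fset_set; set A := (X in (X #<= _)%card).
have inj : {in A &, injective (fun g => enum_rank (Phi g) : nat)}.
  move=> x y; rewrite !inE /= => lx ly /ord_inj/enum_rank_inj [/fP cxy /ffunP e].
  have [//|nxy] := pselect (x = y); exfalso.
  have n1 : x * y^-1 <> 1 by move=> e1; apply: nxy; rewrite -(mulgKV y x) e1 mul1g.
  have [|H [nH HN nHxy]] := det _ n1.
    rewrite (leq_trans (word_length_mul X_gen _ _)) // expnS mul2n -addnn leq_add //.
      exact: leq_trans len.
    by rewrite (leq_trans (word_length_inv X_gen _)) // (leq_trans ly).
  have [c Rc] := Rex H nH HN; apply: nHxy; apply: (FP c) => //.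
  by have := e c; rewrite !ffunE.
have /card_eqPle[_ le] := inj_card_eq inj.
apply: (card_le_trans le); apply: subset_card_le => _ [g _ <-] /=.
exact: ltn_ord.
Qed.
End Bound.

(** * Growth *)

Lemma detects_monotone (G : groupType) (X : set G) n N M :
  N <= M -> detects X n N -> detects X n M.
Proof.
move=> leNM det g g1 lg; have [H [nH HN Hg]] := det g g1 lg.
exists H; split=> //; apply: card_le_trans HN _; apply: subset_card_le => i /= lti.
exact: leq_trans leNM.
Qed.

Lemma res_finite_growthP (G : groupType) (X : set G) n :
  generates X -> finite_set X -> residually_finite G ->
  0 < res_finite_growth X n /\ detects X n (res_finite_growth X n).
Proof.
move=> X_gen X_fin rf; rewrite /res_finite_growth.
set P := (P in least P); suff [N PN] : exists N, P N.
  by have [] := leastP (ex_intro P _ PN).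
have [s sE] := (finite_seqP _).1 (finite_ball X_gen n X_fin).
have /choice[b bP] : forall g : G, exists N : nat, g <> monoid.one ->
    exists H : set G, [/\ is_normal_subgroup H, (left_cosets H #<= `I_N)%card & ~ H g].
  move=> g; have [g1|ng1] := pselect (g = monoid.one); first by exists 0.
  have [H [nH /finite_set_leP[N HN] nHg]] := rf g ng1.
  by exists N => _; exists H.
exists (\max_(g <- s) b g).+1; split=> // g g1 lg.
have gs : g \in s by have : [set` s]%classic g by rewrite -sE.
have [H [nH HN Hg]] := bP g g1.
exists H; split=> //; apply: card_le_trans HN _; apply: subset_card_le => i /= lti.
by rewrite (leq_trans lti) // leqW // leq_bigmax_seq.
Qed.

Lemma growth_le_exp (R : realType) (G : groupType) (X : set G) (alpha : R) :
  (1 < alpha)%R ->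
  growth_le (fun n => (alpha ^+ n)%R%:E) (fun n => Some ((word_growth X n)%:R%:E)) ->
  exists A C, 0 < A /\ forall n, 0 < n -> 2 ^ n <= C * word_growth X (A * n).
Proof.
move=> a1 [C [C0 CP]].
have [e e0 e2] : exists2 e, 0 < e & (2 <= alpha ^+ e)%R.
  have a0 : (0 < alpha - 1)%R by rewrite subr_gt0.
  (* An [e] above [1 / (alpha - 1)], so that Bernoulli's inequality gives [alpha ^+ e] at least
     2. *)
  pose e := (Num.truncn (alpha - 1)^-1).+1; exists e => //.
  have bern m : (1 + (alpha - 1) *+ m <= alpha ^+ m)%R.
    elim: m => [|m IHm]; first by rewrite mulr0n addr0 expr0.
    rewrite exprS -[X in (X * _)%R](subrK 1%R) mulrDl mul1r.
    have : (1 <= alpha ^+ m)%R by rewrite exprn_ege1 // ltW.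
    rewrite mulrS; set u := (alpha ^+ m)%R in IHm *; set v := (_ *+ m)%R in IHm *.
    by move=> u1; nra.
  apply: le_trans (bern e).
  have : (1 <= (alpha - 1) *+ e)%R.
    rewrite -mulr_natr -ler_pdivrMl // mulr1 ltW // truncnS_gt //.
  lra.
exists (C * e), C; split=> [|n n0]; first by rewrite muln_gt0 C0.
have [|y [[<-]]] := CP (e * n); first by rewrite muln_gt0 e0.
rewrite mulnA -EFinM lee_fin -natrM => le.
rewrite -(@ler_nat R); apply: le_trans le.
rewrite exprM natrX; apply: lerXn2r => //; rewrite nnegrE //.
by rewrite (le_trans _ e2).
Qed.

Lemma growth_le_polylog (R : realType) (f : nat -> nat) (r : R) :
  growth_le (fun n => ((f n)%:R)%:E) (log_power r) ->
  exists K k, forall t, 1 < t -> f (2 ^ t) <= K * t ^ k.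
Proof.
move=> [C [C0 CP]].
(* An integer above [r], also for negative [r], where [Num.truncn] is 0. *)
pose k := (Num.truncn r).+1.
exists (C * (C + 1) ^ k), k => t t1.
have [|y []] := CP (2 ^ t); first by rewrite expn_gt0.
rewrite /log_power; case: ifP => // _ [<-].
rewrite -EFinM lee_fin => le; rewrite -(@ler_nat R); apply: le_trans le _.
rewrite -mulnA -expnMn [X in (_ <= X)%R]natrM ler_wpM2l // [X in (_ <= X)%R]natrX -powR_mulrn //.
have t0 : (0 < 2 ^ t)%N by rewrite expn_gt0.
have ln2 : (1 / 2 <= ln 2 :> R)%R.
  have := @le_ln1Dx R (- (1 / 2))%R; rewrite (_ : 1 + - (1 / 2) = 2^-1)%R; last by field.
  rewrite lnV ?posrE //; move=> /(_ ltac:(lra)); lra.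
have ln2' : (ln 2 <= 1 :> R)%R.
  by have := @le_ln1Dx R 1; rewrite (_ : 1 + 1 = 2)%R //; apply; lra.
have lnC : (0 <= ln (C%:R : R) <= C%:R)%R.
  rewrite ln_ge0 ?ler1n //=.
  have := @le_ln1Dx R (C%:R - 1)%R; rewrite (_ : 1 + (C%:R - 1) = C%:R)%R; last by ring.
  have : (1 <= C%:R :> R)%R by rewrite ler1n.
  by move=> c1 /(_ ltac:(lra)); lra.
have t1' : (2 <= t%:R :> R)%R by rewrite ler_nat.
have lnE : ln ((C * 2 ^ t)%:R : R) = (ln C%:R + ln 2 * t%:R)%R.
  rewrite natrM lnM ?posrE ?ltr0n // natrX lnXn //.
  by rewrite mulr_natr.
(* The logarithm must be at least 1 for the exponent [r] to be raised to [k]; this is where [1 < t]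
   enters. *)
have l1 : (1 <= ln ((C * 2 ^ t)%:R : R))%R by rewrite lnE; nra.
apply: (@le_trans _ _ (ln ((C * 2 ^ t)%:R : R) `^ k%:R)%R).
  by apply: ler_powR => //; rewrite ltW // truncnS_gt.
apply: ge0_ler_powR; rewrite ?nnegrE //; first by rewrite (le_trans _ l1).
rewrite lnE natrM natrD; nra.
Qed.

(** With [s = 2 ^ v], the number [b] is linear in [v]. The second logarithm of the left side is at
    most a quartic polynomial in [b], hence [O(v ^ 4)], and is overtaken by [s]. *)
Lemma iterated_exp_gt_quasipoly a C K k d :
  exists2 s, 0 < s & exists b, K * (s + a).+1 ^ k <= 2 ^ b /\
    forall N, N <= 2 ^ b ->
      C * N.+1 ^ (N.+1 ^ (b.+1 * (b.+1 + b.+1 * b.+1 + d).+1)) < 2 ^ (2 ^ s).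
Proof.
pose e := (k + K * (a + 2) ^ k).+1.
have [v0 v0P] := poly_lt_exp (C + e + e * e * (e + e * e + d).+1) 4.
pose v := v0.+1; exists (2 ^ v); first by rewrite expn_gt0.
exists (v * k + K * (a + 2) ^ k); set b := (v * k + _)%N.
have leb : b.+1 <= e * v by rewrite /b /e /v; nia.
split=> [|N leN].
  apply: (@leq_trans (K * (2 ^ v * (a + 2)) ^ k)).
    rewrite leq_mul2l; apply/orP; right; case: (k) => // k'; rewrite leq_exp2r //.
    have : 0 < 2 ^ v by rewrite expn_gt0.
    by move: (2 ^ v) => V; nia.
  rewrite expnMn mulnCA expnD -expnM leq_mul2l; apply/orP; right.
  by rewrite ltnW // ltn_expl.
have leN' : N.+1 <= 2 ^ b.+1.
  by rewrite (leq_ltn_trans leN) // ltn_exp2l.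
set P := (_ * _.+1).
have leP : N.+1 ^ (N.+1 ^ P) <= 2 ^ (b.+1 * 2 ^ (b.+1 * P)).
  rewrite expnM; apply: (@leq_trans ((2 ^ b.+1) ^ (N.+1 ^ P))); first by rewrite leq_exp2r ?expn_gt0.
  rewrite leq_exp2l; last by rewrite -[1]/(2 ^ 0) ltn_exp2l.
  by rewrite expnM leq_exp2r // /P muln_gt0.
apply: (@leq_ltn_trans (2 ^ (C + b.+1 * 2 ^ (b.+1 * P)))).
  by rewrite expnD leq_mul // ltnW // ltn_expl.
rewrite ltn_exp2l //.
apply: (@leq_ltn_trans (2 ^ (C + b.+1 + b.+1 * P))).
  rewrite !expnD; have := ltn_expl C (ltnSn 1); have := ltn_expl b.+1 (ltnSn 1).
  have : 0 < 2 ^ (b.+1 * P) by rewrite expn_gt0.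
  move: (2 ^ (b.+1 * P)) (2 ^ C) (2 ^ b.+1) => x y z x0 bz Cy.
  apply: (@leq_trans (y.-1 * x + b.+1 * x)); first by rewrite leq_add2r; nia.
  by rewrite -mulnDl leq_mul2r; apply/orP; right; nia.
rewrite ltn_exp2l //; apply: leq_ltn_trans (v0P v (ltnSn v0)).
have v1 : 0 < v by [].
move: (v) (e) leb v1 => w f leb w1; rewrite /P; move: (b.+1) leb => c lec.
have lec4 : c <= f * w ^ 4.
  by rewrite (leq_trans lec) // leq_mul2l -[X in X <= _]expn1 leq_pexp2l // orbT.
have leC : C <= C * w ^ 4 by rewrite leq_pmulr // expn_gt0 w1.
rewrite 2!mulnDl !leq_add //.
rewrite mulnA; apply: (@leq_trans ((f * w) * (f * w) * ((f + f * f + d).+1 * w ^ 2))).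
  rewrite !leq_mul //; have : c * c <= (f * w) * (f * w) by rewrite leq_mul.
  move: lec; rewrite expnS expn1; nia.
by apply: eq_leq; rewrite !expnS expn0; ring.
Qed.

Theorem proposition2p4 (R : realType) (G : groupType) (X : set G)
  (X_fin : finite_set X) (X_gen : generates X)
  (G_rf : residually_finite G)
  (exp_growth : exists alpha : R, (1 < alpha)%R /\
     growth_le (fun n => (alpha ^+ n)%R%:E)
               (fun n => Some ((word_growth X n)%:R%:E))) :
  forall r : R,
    ~ growth_le (fun n => ((res_finite_growth X n)%:R)%:E) (log_power r).
Proof.
move=> r /growth_le_polylog[K [k FK]].
have det t : 1 < t -> detects X (2 ^ t) (K * t ^ k).
  move=> /FK/detects_monotone; apply.
  by have [] := res_finite_growthP (2 ^ t) X_gen X_fin G_rf.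
have [N0 prime_bound] := prime_quotient_bounded X_gen det.
have [B [d ballP]] := ball_bound X_gen X_fin prime_bound.
have [alpha [alpha1 /(growth_le_exp alpha1)[A [C [A0 AC]]]]] := exp_growth.
(* Growth is tested at [2 ^ s]. The ball of radius [A * 2 ^ s] lies in that of radius [2 ^ (s + A)],
   whose quotients [x * y^-1] are detected at [t = (s + A).+1]. *)
have [s s0 [b [leb small]]] := iterated_exp_gt_quasipoly A (C * B) K k d.
have := AC (2 ^ s); rewrite expn_gt0 => /(_ isT); apply/negP; rewrite -ltnNge.
apply: leq_ltn_trans (small _ leb); rewrite -mulnA leq_mul2l; apply/orP; right.
apply: (ballP (s + A)) => //; first by apply: det; rewrite ltnS addn_gt0 s0.
by rewrite expnD mulnC leq_mul2l ltnW ?orbT // ltn_expl.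
Qed.
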